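(* Let $f:\mathbf{R}^N\to\mathbf{R}$ be partially separable of degree $\omega$ with block Lipschitz gradient with constants $L=(L_1,\dots,L_n)$. Let $\hat S$ be a proper doubly uniform sampling. Then $$(f,\hat S)\sim ESO\left(1+\frac{(\omega-1)\left(\frac{\mathbf{E}[|\hat S|^2]}{\mathbf{E}[|\hat S|]}-1\right)}{\max(1,n-1)},\,L\right).$$
   Context: Blocks: $[n]=\{1,\dots,n\}$; $N=N_1+\dots+N_n$ with $N_i\ge1$; $U=[U_1,\dots,U_n]$ is a column permutation of the $N\times N$ identity matrix, with $U_i$ of size $N\times N_i$. For $x\in\mathbf{R}^N$, the $i$-th block is $x^{(i)}=U_i^Tx\in\mathbf{R}^{N_i}$, and for $S\subseteq[n]$, $x_{[S]}=\sum_{i\in S}U_ix^{(i)}$. $\langle\cdot,\cdot\rangle$ is the Euclidean inner product. For fixed symmetric positive definite matrices $B_i\in\mathbf{R}^{N_i\times N_i}$, $\|t\|_{(i)}=\langle B_it,t\rangle^{1/2}$ and $\|t\|_{(i)}^*=\langle B_i^{-1}t,t\rangle^{1/2}$. For $w\in\mathbf{R}^n_{++}$ (positive entries), $\|x\|_w=(\sum_{i=1}^nw_i\|x^{(i)}\|_{(i)}^2)^{1/2}$. Partially separable of degree $\omega$ ($\omega$ an integer, $1\le\omega\le n$): $f=\sum_{J\in\mathcal{J}}f_J$, where $\mathcal{J}$ is a finite collection, possibly with repetitions, of nonempty subsets of $[n]$ with $|J|\le\omega$ for all $J\in\mathcal{J}$, and each $f_J:\mathbf{R}^N\to\mathbf{R}$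 is convex, differentiable and depends on the blocks $x^{(i)}$, $i\in J$, only. Block Lipschitz gradient with constants $L_1,\dots,L_n>0$: $\|U_i^T\nabla f(x+U_it)-U_i^T\nabla f(x)\|_{(i)}^*\le L_i\|t\|_{(i)}$ for all $x\in\mathbf{R}^N$, $i\in[n]$, $t\in\mathbf{R}^{N_i}$. A sampling $\hat S$ is a random subset of $[n]$. It is proper if $\mathbf{P}(i\in\hat S)>0$ for all $i$, uniform if $\mathbf{P}(i\in\hat S)$ does not depend on $i$, and doubly uniform if $\mathbf{P}(\hat S=S')=\mathbf{P}(\hat S=S'')$ whenever $|S'|=|S''|$ (a doubly uniform sampling is uniform). ESO: for $\beta>0$, $w\in\mathbf{R}^n_{++}$ and a proper uniform sampling $\hat S$, $(f,\hat S)\sim ESO(\beta,w)$ means that for all $x,h\in\mathbf{R}^N$, $$\mathbf{E}[f(x+h_{[\hat S]})]\le f(x)+\tfrac{\mathbf{E}[|\hat S|]}{n}\left(\langle\nabla f(x),h\rangle+\tfrac\beta2\|h\|_w^2\right).$$ *)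

(* Defs.v *)
From HB Require Import structures.
From mathcomp Require Import all_boot all_order all_algebra all_fingroup.
From mathcomp Require Import all_classical all_reals all_analysis.

Set Implicit Arguments.
Unset Strict Implicit.
Unset Printing Implicit Defensive.

Import Order.TTheory GRing.Theory Num.Theory.
Import numFieldNormedType.Exports.

Local Open Scope classical_set_scope.
Local Open Scope ring_scope.

Section EuclideanSpace.
Context {R : realType}.

Definition inner (m : nat) (x y : 'cV[R]_m) : R := \sum_j x j 0 * y j 0.

Definition gradient (m : nat) (f : 'cV[R]_m -> R) (x : 'cV[R]_m) : 'cV[R]_m :=
  \col_j 'D_(delta_mx j 0) f x.

Definition sym_posdef (m : nat) (A : 'M[R]_m) : Prop :=
  A^T = A /\ forall t : 'cV[R]_m, t != 0 -> 0 < inner (A *m t) t.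

End EuclideanSpace.

(* The ambient dimension is N = \sum_i Nb i; the permutation s encodes the
   column permutation U = col_perm s 1%:M of the identity matrix. *)
Section Blocks.
Context {R : realType} {n : nat} {Nb : 'I_n -> nat}.
Implicit Types (s : 'S_(\sum_i Nb i)%N) (x : 'cV[R]_(\sum_i Nb i)%N).

Definition Ublock s (i : 'I_n) : 'M[R]_((\sum_i Nb i)%N, Nb i) :=
  submxrow (col_perm s 1%:M) i.

Definition blk s x (i : 'I_n) : 'cV[R]_(Nb i) := (Ublock s i)^T *m x.

(* x_[S] *)
Definition restr s x (S : {set 'I_n}) : 'cV[R]_(\sum_i Nb i)%N :=
  \sum_(i in S) Ublock s i *m blk s x i.

Implicit Type B : forall i : 'I_n, 'M[R]_(Nb i).

Definition bnorm B (i : 'I_n) (t : 'cV[R]_(Nb i)) : R :=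
  Num.sqrt (inner (B i *m t) t).

Definition bnorm_dual B (i : 'I_n) (t : 'cV[R]_(Nb i)) : R :=
  Num.sqrt (inner (invmx (B i) *m t) t).

Definition wnorm s B (w : 'I_n -> R) x : R :=
  Num.sqrt (\sum_i w i * bnorm B (blk s x i) ^+ 2).

Definition depends_only_on s (J : {set 'I_n})
    (g : 'cV[R]_(\sum_i Nb i)%N -> R) : Prop :=
  forall x y, (forall i, i \in J -> blk s x i = blk s y i) -> g x = g y.

(* The collection of subsets, possibly with repetitions, is the finite family
   (J k), k < m, and fJ k is the summand attached to its k-th member. *)
Definition partially_separable s (omega : nat)
    (f : 'cV[R]_(\sum_i Nb i)%N -> R) : Prop :=
  (1 <= omega <= n)%N /\
  exists (m : nat) (J : 'I_m -> {set 'I_n})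
         (fJ : 'I_m -> 'cV[R]_(\sum_i Nb i)%N -> R),
    [/\ forall k, J k != finset.set0 /\ (#|J k| <= omega)%N,
        forall k, convex_function setT (fJ k),
        forall k x, differentiable (fJ k) x,
        forall k, depends_only_on s (J k) (fJ k)
      & forall x, f x = \sum_k fJ k x].

Definition block_lipschitz s B (L : 'I_n -> R)
    (f : 'cV[R]_(\sum_i Nb i)%N -> R) : Prop :=
  (forall i, 0 < L i) /\
  forall x (i : 'I_n) (t : 'cV[R]_(Nb i)),
    bnorm_dual B (blk s (gradient f (x + Ublock s i *m t)) i
                  - blk s (gradient f x) i) <= L i * bnorm B t.

End Blocks.

Section Samplings.
Context {R : realType} {d : measure_display} {T : measurableType d}.
Context (P : probability T R) {n : nat} (S : T -> {set 'I_n}).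

(* Measurability of S for the discrete sigma-algebra on the subsets of [n]. *)
Definition sampling : Prop :=
  forall A : {set 'I_n}, measurable [set w | S w = A].

Definition proper_sampling : Prop :=
  forall i : 'I_n, (0 < P [set w | i \in S w])%E.

Definition uniform_sampling : Prop :=
  forall i j : 'I_n, P [set w | i \in S w] = P [set w | j \in S w].

Definition doubly_uniform_sampling : Prop :=
  forall A B : {set 'I_n}, #|A| = #|B| ->
    P [set w | S w = A] = P [set w | S w = B].

(* E[|S|^k]; the expectation is finite since |S| <= n. *)
Definition card_moment (k : nat) : R :=
  fine ('E_P[(fun w => #|S w|%:R ^+ k)%R])%E.

End Samplings.

Definition ESO {R : realType} {n : nat} {Nb : 'I_n -> nat}
    (s : 'S_(\sum_i Nb i)%N) (B : forall i, 'M[R]_(Nb i))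
    {d : measure_display} {T : measurableType d} (P : probability T R)
    (f : 'cV[R]_(\sum_i Nb i)%N -> R) (S : T -> {set 'I_n})
    (beta : R) (w : 'I_n -> R) : Prop :=
  [/\ 0 < beta,
      forall i, 0 < w i,
      [/\ sampling S, proper_sampling P S & uniform_sampling P S]
    & forall x h : 'cV[R]_(\sum_i Nb i)%N,
        ('E_P[(fun u => f (x + restr s h (S u)))%R]
         <= (f x + card_moment P S 1 / n%:R
               * (inner (gradient f x) h
                  + beta / 2 * wnorm s B w h ^+ 2))%R%:E)%E ].

(* Main.v *)
Require Import Defs.
From HB Require Import structures.
From mathcomp Require Import all_boot all_order all_algebra all_fingroup.
From mathcomp Require Import all_classical all_reals all_analysis.
From mathcomp Require Import ring lra.
Import Order.TTheory GRing.Theory Num.Theory.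
Import numFieldNormedType.Exports.
Local Open Scope ring_scope.
Set Implicit Arguments.
Unset Strict Implicit.
Unset Printing Implicit Defensive.

(** Enlarging the index sets, one may assume [|J| = omega] for every summand
    [f_J].  For a fixed value [A] of the sampling and [k = |A :&: J|], convexity
    gives
      f_J (x + h_[A]) - f_J x
        <= \sum_(i in A :&: J) k^-1 (f_J (x + k U_i h^(i)) - f_J x).
    The law of the sampling is invariant under permutations of [n], so, after
    taking expectations, [J] can be replaced in the [i]-th term by a fixed set
    [J0 i] of cardinality [omega] containing [i].  The number [k] no longer
    depends on [J], the terms sum over [J] to increments of [f] along the block
    [i], and the descent lemma for block Lipschitz gradients bounds them by
    [k <grad f x, U_i h^(i)> + k^2 L_i / 2 |h^(i)|^2].  What remains is
    [E (i \in S)] and [E ((i \in S) |S :&: J0 i|)], which permutation invariance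
    expresses through [E |S|] and [E |S|^2]. *)

(** * Finite preliminaries: Jensen's inequality, supersets and permutations *)

(** Induction on the list: the mean of [y :: r] is a convex combination of [y] and the mean of
    [r]. *)
Lemma le_convex_mean (R : realType) (E : lmodType R) (f : E -> R) (r : seq E) :
  convex_function (classical_sets.setT : set (convex_lmodType E)) f ->
  r != [::] ->
  f ((size r)%:R^-1 *: \sum_(y <- r) y) <= (size r)%:R^-1 * \sum_(y <- r) f y.
Proof.
move=> fconv; elim: r => // y r IHr _; case: (eqVneq r [::]) => [->|r0].
  by rewrite !big_seq1 /= invr1 scale1r mul1r.
have {IHr} := IHr r0; rewrite !big_cons /=.
set m := size r; set v := \sum_(z <- r) z; set w := \sum_(z <- r) f z => IHr.
have m0 : 0 < m%:R :> R by rewrite ltr0n lt0n /m size_eq0.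
have mS : m.+1%:R = m%:R + 1 :> R by rewrite -natr1.
have t01 : 0 <= (m.+1%:R^-1 : R) <= 1.
  by rewrite invr_ge0 ler0n invf_le1 ?ltr0n // ler1n.
(* With weight 1/(m+1) on [y], the mean of [r] gets m/(m+1), so every element ends with weight
   1/(m+1). *)
pose t := Itv01 (proj1 (andP t01)) (proj2 (andP t01)).
have := fconv t y (m%:R^-1 *: v); rewrite !inE => /(_ I I).
rewrite [X in f X](_ : _ = m.+1%:R^-1 *: (y + v)); last first.
  rewrite /conv/= /unstable.onem scalerA scalerDr; congr (_ + _ *: _).
  by rewrite mS; field; rewrite gt_eqF ?gt_eqF ?addr_gt0.
move/le_trans; apply.
rewrite convRE /= /unstable.onem mulrDr lerD2l.
rewrite (_ : m.+1%:R^-1 * w = (1 - m.+1%:R^-1) * (m%:R^-1 * w)).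
  by apply: ler_wpM2l => //; rewrite subr_ge0; case/andP: (t01).
by rewrite mS; field; rewrite gt_eqF ?gt_eqF ?addr_gt0.
Qed.

Lemma exists_superset_card (T : finType) (A : {set T}) (k : nat) :
  (#|A| <= k <= #|T|)%N -> exists2 B : {set T}, A \subset B & #|B| = k.
Proof.
case/andP; elim: k => [|k IHk] Ak kT.
  by exists A => //; apply/eqP; rewrite -leqn0.
move: Ak; rewrite leq_eqVlt => /orP[/eqP <-|]; first by exists A.
rewrite ltnS => Ak; have [B AB Bk] := IHk Ak (ltnW kT).
have : (0 < #|~: B|)%N by rewrite cardsCs finset.setCK Bk subn_gt0.
case/card_gt0P => x; rewrite inE => xB.
exists (x |: B); first exact: fintype.subset_trans AB (finset.subsetUr _ _).
by rewrite cardsU1 xB Bk.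
Qed.

(** List the elements with [i] first, then the rest of the set, then its complement. Matching
    positions in the lists of [J] and [J'] gives a permutation that fixes [i] and carries [J] onto
    [J']. *)
Lemma exists_perm_fixing (T : finType) (i : T) (J J' : {set T}) :
  i \in J -> i \in J' -> #|J| = #|J'| ->
  exists2 p : {perm T}, p i = i & forall j, (p j \in J') = (j \in J).
Proof.
move=> iJ iJ' cJ.
pose l (K : {set T}) := i :: enum (K :\ i) ++ enum (~: K).
have lE (K : {set T}) x : i \in K -> x \in l K.
  move=> iK; rewrite inE mem_cat !mem_enum !inE.
  by case: eqVneq => //= _; case: (x \in K).
have lu (K : {set T}) : i \in K -> uniq (l K).
  move=> iK /=; rewrite mem_cat !mem_enum !inE eqxx iK /= cat_uniq !enum_uniq /= andbT.
  by apply/hasPn => x; rewrite !mem_enum !inE => /negbTE ->; rewrite andbF.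
have ls (K : {set T}) : i \in K -> size (l K) = #|T|.
  move=> iK; rewrite cardE; apply/perm_size/uniq_perm; rewrite ?enum_uniq ?lu //.
  by move=> x; rewrite lE // mem_enum.
(* Membership in [K] is read off the position: [K] fills exactly the first [#|K|] places, [i] being
   counted at place 0. *)
have lJ (K : {set T}) m : i \in K -> (m < #|T|)%N -> (nth i (l K) m \in K) = (m < #|K|)%N.
  move=> iK mT; have cK : #|K| = (size (enum (K :\ i))).+1.
    by rewrite -cardE (cardsD1 i K) iK.
  case: m mT => [|m] mT; first by rewrite /= iK cK.
  rewrite /= nth_cat cK ltnS; case: ifP => ms.
    by have := mem_nth i ms; rewrite mem_enum !inE => /andP[].
  have : (m - size (enum (K :\ i)) < size (enum (~: K)))%N.
    rewrite ltn_subLR; last by rewrite leqNgt ms.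
    by move: mT; rewrite -(ls K iK) /= ltnS size_cat.
  by move=> /(mem_nth i); rewrite mem_enum !inE => /negbTE.
pose g x := nth i (l J') (index x (l J)).
have idx x : (index x (l J) < #|T|)%N by rewrite -(ls J iJ) index_mem lE.
have ginj : injective g.
  move=> x y /eqP; rewrite nth_uniq ?ls ?lu // => /eqP/(congr1 (nth i (l J))).
  by rewrite !nth_index ?lE.
exists (perm ginj); first by rewrite permE /g /= eqxx.
move=> j; rewrite permE /g lJ // -cJ -lJ // nth_index //; exact: lE.
Qed.

(** * The Euclidean inner product and positive definite matrices *)

Section Inner.
Context {R : realType} {m : nat}.
Implicit Types (x y z : 'cV[R]_m) (A : 'M[R]_m).

Lemma innerC x y : inner x y = inner y x.
Proof. by apply: eq_bigr => j _; rewrite mulrC. Qed.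

Lemma innerDl x y z : inner (x + y) z = inner x z + inner y z.
Proof. by rewrite -big_split; apply: eq_bigr => j _; rewrite mxE mulrDl. Qed.

Lemma innerZl (a : R) x y : inner (a *: x) y = a * inner x y.
Proof. by rewrite mulr_sumr; apply: eq_bigr => j _; rewrite mxE mulrA. Qed.

Lemma innerDr x y z : inner z (x + y) = inner z x + inner z y.
Proof. by rewrite !(innerC z) innerDl. Qed.

Lemma innerZr (a : R) x y : inner y (a *: x) = a * inner y x.
Proof. by rewrite !(innerC y) innerZl. Qed.

Lemma inner0r x : inner x 0 = 0.
Proof. by rewrite -(scale0r 0) innerZr mul0r. Qed.

Lemma inner_sumr (I : Type) (r : seq I) (Q : pred I) (F : I -> 'cV[R]_m) x :
  inner x (\sum_(i <- r | Q i) F i) = \sum_(i <- r | Q i) inner x (F i).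
Proof.
by elim/big_rec2: _ => [|i ? ? _ <-]; rewrite ?inner0r // innerDr.
Qed.

Lemma inner_mulmxr (k : nat) (A : 'M[R]_(m, k)) x (y : 'cV[R]_k) :
  inner x (A *m y) = inner (A^T *m x) y.
Proof.
under [LHS]eq_bigr do rewrite mxE mulr_sumr.
rewrite exchange_big; apply: eq_bigr => j _; rewrite mxE mulr_suml.
by apply: eq_bigr => i _; rewrite mxE mulrCA mulrA.
Qed.

Lemma sym_posdef_ge0 A x : sym_posdef A -> 0 <= inner (A *m x) x.
Proof.
by case=> _ Apos; case: (eqVneq x 0) => [->|/Apos/ltW //]; rewrite inner0r.
Qed.

Lemma sym_posdef_unitmx A : sym_posdef A -> A \in unitmx.
Proof.
case=> Asym Apos; rewrite -row_free_unit; apply: inj_row_free => v vA0.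
apply/eqP; apply: contraT; rewrite -trmx_eq0 => /Apos.
by rewrite -[X in X *m _]Asym -trmx_mul vA0 trmx0 innerC inner0r ltxx.
Qed.

(** Duality of the two norms, obtained from the usual Cauchy-Schwarz argument for the form of [A] at
    [c] and [y], where x = A c. *)
Lemma sym_posdef_CauchySchwarz A x y : sym_posdef A ->
  inner x y <= Num.sqrt (inner (invmx A *m x) x) * Num.sqrt (inner (A *m y) y).
Proof.
move=> Apd; have Au := sym_posdef_unitmx Apd; have [Asym Apos] := Apd.
pose c := invmx A *m x; have xE : x = A *m c by rewrite mulKVmx.
set X := inner (invmx A *m x) x; set Y := inner (A *m y) y; set Z := inner x y.
have XE : X = inner (A *m c) c by rewrite -xE innerC.
have ZE : inner (A *m y) c = Z.
  by rewrite innerC inner_mulmxr Asym -xE.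
rewrite -sqrtrM ?XE ?sym_posdef_ge0 // -XE.
apply: (le_trans (ler_norm _)); rewrite -sqrtr_sqr ler_wsqrtr //.
case: (eqVneq y 0) => [y0|/Apos Y0].
  by rewrite /Z /Y y0 !inner0r expr0n mulr0.
(* The form at Y c - Z y expands to Y (X Y - Z^2), and Y > 0 can be cancelled. *)
have := sym_posdef_ge0 (Y *: c + (- Z) *: y) Apd.
rewrite mulmxDr -!scalemxAr !innerDl !innerDr !innerZl !innerZr ZE -xE -/Z -/Y.
rewrite xE -XE => H.
have : 0 <= Y * (X * Y - Z ^+ 2) by move: H; congr (_ <= _); ring.
by rewrite pmulr_rge0 // subr_ge0.
Qed.

End Inner.

(** * Decomposition of vectors into blocks *)

Section Block.
Context {R : realType} {n : nat} {Nb : 'I_n -> nat} (s : 'S_(\sum_i Nb i)%N).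
Implicit Types (x : 'cV[R]_(\sum_i Nb i)%N).

Lemma blkD x y i : blk s (x + y) i = blk s x i + blk s y i.
Proof. exact: mulmxDr. Qed.

(** This is U U^T = 1 for the permutation matrix U, written blockwise. *)
Lemma sum_Ublock_blk x : \sum_i Ublock s i *m blk s x i = x.
Proof.
pose U : 'M[R]_(\sum_i Nb i)%N := col_perm s 1%:M.
transitivity ((\sum_i submxrow U i *m submxcol U^T i) *m x).
  by rewrite mulmx_suml; apply: eq_bigr => i _; rewrite /blk mulmxA tr_submxrow.
rewrite -mul_mxrow_mxcol submxrowK submxcolK.
by rewrite /U col_permE mul1mx tr_perm_mx -perm_mxM mulgV perm_mx1 mul1mx.
Qed.

(** The blocks of U^T U = 1: diagonal ones are identities, the others vanish. *)
Lemma tr_Ublock_mul i j : (Ublock s i)^T *m Ublock s j =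
  submxblock (1%:M : 'M[R]_(\sum_i Nb i)%N) i j.
Proof.
rewrite /Ublock tr_submxrow mul_submxrow submxcol_mul -submxblockEv.
by rewrite col_permE mul1mx tr_perm_mx -perm_mxM mulVg perm_mx1.
Qed.

Lemma blk_Ublock i (t : 'cV[R]_(Nb i)) : blk s (Ublock s i *m t) i = t.
Proof.
by rewrite /blk mulmxA tr_Ublock_mul -mxdiagZ submxblock_diag mul1mx.
Qed.

Lemma blk_Ublock_neq i j (t : 'cV[R]_(Nb i)) :
  j != i -> blk s (Ublock s i *m t) j = 0.
Proof.
move=> ji; rewrite /blk mulmxA tr_Ublock_mul -mxdiagZ mxblockK (negbTE ji).
by rewrite mul0mx.
Qed.

Lemma blk_restr x (A : {set 'I_n}) j :
  blk s (restr s x A) j = if j \in A then blk s x j else 0.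
Proof.
rewrite /restr {1}/blk mulmx_sumr; case: ifPn => jA.
  rewrite (bigD1 j) //= [X in X + _]blk_Ublock big1 ?addr0 // => i /andP[_ ij].
  by apply: blk_Ublock_neq; rewrite eq_sym.
by rewrite big1 // => i iA; apply: blk_Ublock_neq; apply: contraNneq jA => ->.
Qed.

Lemma bnormZ (B : forall i, 'M[R]_(Nb i)) i (a : R) (t : 'cV[R]_(Nb i)) :
  bnorm B (a *: t) = `|a| * bnorm B t.
Proof.
rewrite /bnorm -scalemxAr innerZl innerZr mulrA sqrtrM ?sqr_ge0 // -expr2.
by rewrite sqrtr_sqr.
Qed.

End Block.

(** * Gradients along lines and the descent lemma for one block *)

Section Descent.
Context {R : realType}.

Lemma inner_gradient (m : nat) (f : 'cV[R]_m -> R) x v :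
  differentiable f x -> inner (gradient f x) v = 'D_v f x.
Proof.
move=> df; rewrite deriveE // [in RHS](matrix_sum_delta v) linear_sum.
apply: eq_bigr => j _; rewrite big_ord1 linearZ /= mxE deriveE //.
by rewrite mulrC.
Qed.

Lemma is_derive_line (m : nat) (f : 'cV[R]_m -> R) x v (t : R) :
  differentiable f (x + t *: v) ->
  is_derive t 1 (fun u : R => f (x + u *: v)) (inner (gradient f (x + t *: v)) v).
Proof.
move=> df; have dl : is_diff t (fun u : R => x + u *: v) (fun u => u *: v).
  have := is_diffD (is_diff_cst x t) (is_diff_scalel t v).
  by rewrite add0r.
have dfl : differentiable (f \o (fun u : R => x + u *: v)) t.
  exact: differentiable_comp.
apply: DeriveDef; first exact/derivable1_diffP.
rewrite deriveE // diff_comp // inner_gradient // deriveE //=.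
by rewrite diff_val scale1r.
Qed.

(** The mean value theorem replaces integration: subtracting the quadratic upper model from [f]
    along the segment leaves a function with nonpositive derivative. *)
Lemma block_descent {n : nat} {Nb : 'I_n -> nat} (s : 'S_(\sum_i Nb i)%N)
    (B : forall i, 'M[R]_(Nb i)) (L : 'I_n -> R)
    (f : 'cV[R]_(\sum_i Nb i)%N -> R) :
  (forall i, sym_posdef (B i)) -> (forall x, differentiable f x) ->
  block_lipschitz s B L f -> forall x i (t : 'cV[R]_(Nb i)),
  f (x + Ublock s i *m t) <=
    f x + inner (gradient f x) (Ublock s i *m t) + L i / 2 * bnorm B t ^+ 2.
Proof.
move=> Bpd df [L0 fL] x i t; set v := Ublock s i *m t.
pose G u := inner (gradient f (x + u *: v)) v.
set c := L i * bnorm B t ^+ 2.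
(* The slope [G] grows at rate at most [c]: pair the gradient increment with [t] by the dual
   Cauchy-Schwarz inequality, then apply the Lipschitz bound to the step [u *: t]. *)
have GE (u : R) : 0 <= u -> G u <= G 0 + u * c.
  move=> u0; rewrite addrC -lerBlDr /G scale0r addr0 /v !inner_mulmxr -!/(blk _ _ _).
  set a := blk _ _ _; set b := blk _ _ _.
  rewrite -mulN1r -innerZl -innerDl scaleN1r.
  apply: (le_trans (sym_posdef_CauchySchwarz _ _ (Bpd i))).
  have := fL x i (u *: t); rewrite -scalemxAr -/v -/a -/b /bnorm_dual => H.
  apply: (le_trans (ler_wpM2r (sqrtr_ge0 _) H)).
  by rewrite bnormZ ger0_norm // /c /bnorm expr2; lra.
(* The derivative of [g] is G u - G 0 - c u, which [GE] makes nonpositive for u >= 0. *)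
pose g (u : R) := f (x + u *: v) - u * G 0 - c / 2 * u ^+ 2.
have dg (u : R) : is_derive u 1 g (G u - G 0 - c * u).
  have fd := is_derive_line (df (x + u *: v)).
  have -> : g = ((fun u => f (x + u *: v)) - (G 0 \*: id)
                 - ((c / 2) \*: (id ^+ 2 : R -> R))).
    by apply/funext => y; rewrite /g !fctE /= /GRing.scale /= (mulrC y).
  apply: is_derive_eq.
  by rewrite /GRing.scale /= -/(G u) /=; lra.
have [|w w01] := @MVT R g (fun u => G u - G 0 - c * u) 0 1 ltr01.
  by apply: derivable_within_continuous => u _; case: (dg u).
rewrite subr0 mulr1 /g scale1r scale0r addr0 /G scale0r addr0 -/(G w) => E.
have w0 : 0 <= w by move: w01; rewrite in_itv /= => /andP[/ltW].
have := GE w w0; rewrite [X in _ <= X + _]/G scale0r addr0 /c; move: E.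
by rewrite /c; nra.
Qed.

End Descent.

(** * Moments of weights on subsets that depend on the cardinality only *)

Section SymmetricWeights.
Context {R : realType} {n : nat} (q : {set 'I_n} -> R).
Context (q_card : forall A B : {set 'I_n}, #|A| = #|B| -> q A = q B).

(** The image under [p] permutes the subsets and keeps cardinalities, hence weights. *)
Lemma sum_weight_perm (p : 'S_n) (F : {set 'I_n} -> R) :
  \sum_A q A * F (p @: A) = \sum_A q A * F A.
Proof.
rewrite [RHS](reindex_inj (imset_inj (@perm_inj _ p))) /=.
by apply: eq_bigr => A _; rewrite (q_card (card_imset _ (@perm_inj _ p))).
Qed.

Lemma sum_weight_mem (i j : 'I_n) (G : nat -> R) :
  \sum_A q A * ((i \in A)%:R * G #|A|) = \sum_A q A * ((j \in A)%:R * G #|A|).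
Proof.
rewrite -(sum_weight_perm (tperm i j)); apply: eq_bigr => A _.
rewrite -{1}(tpermR i j) (finset.mem_imset _ _ (@perm_inj _ _)).
by rewrite (card_imset _ (@perm_inj _ _)).
Qed.

Lemma sum_weight_mem2 (i j k : 'I_n) : j != i -> k != i ->
  \sum_A q A * ((i \in A)%:R * (j \in A)%:R) =
  \sum_A q A * ((i \in A)%:R * (k \in A)%:R).
Proof.
move=> ji ki; have [p pi pk] : exists2 p : 'S_n, p i = i & p k = j.
  by exists (tperm j k); rewrite ?tpermR // tpermD.
rewrite -[LHS](sum_weight_perm p); apply: eq_bigr => A _.
by rewrite -{1}pi -{1}pk !(finset.mem_imset _ _ (@perm_inj _ _)).
Qed.

(** This lets one reference set stand in for every set of the same size containing [i]: move [J] to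
    [J'] by a permutation fixing [i]. *)
Lemma sum_weight_setI (i : 'I_n) (J J' : {set 'I_n}) (G : nat -> R) :
  i \in J -> i \in J' -> #|J| = #|J'| ->
  \sum_A q A * ((i \in A)%:R * G #|A :&: J|) =
  \sum_A q A * ((i \in A)%:R * G #|A :&: J'|).
Proof.
move=> iJ iJ' cJ; have [p pi pJ] := exists_perm_fixing iJ iJ' cJ.
rewrite -[RHS](sum_weight_perm p); apply: eq_bigr => A _.
rewrite -{2}pi (finset.mem_imset _ _ (@perm_inj _ _)); congr (_ * (_ * G _)).
(* The intersection of [p @: A] with [J'] is the image under [p] of [A :&: J]. *)
rewrite -(card_imset _ (@perm_inj _ p)); congr #|pred_of_set _|.
apply/setP => x; rewrite -(permKV p x) !inE !(finset.mem_imset _ _ (@perm_inj _ _)).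
by rewrite !inE pJ.
Qed.

Let M k := \sum_A q A * #|A|%:R ^+ k.

Lemma sum_mem_natr (A J : {set 'I_n}) :
  \sum_(j in J) (j \in A)%:R = #|A :&: J|%:R :> R.
Proof.
rewrite -natr_sum -sum1_card big_mkcond [in RHS]big_mkcond /=; congr _%:R.
by apply: eq_bigr => j _; rewrite inE; do 2 case: (_ \in _).
Qed.

Lemma sum_mem_natrT (A : {set 'I_n}) : \sum_j (j \in A)%:R = #|A|%:R :> R.
Proof.
by rewrite -[in RHS](finset.setIT A) -sum_mem_natr; apply: eq_bigl => j; rewrite inE.
Qed.

(** By symmetry the value is the same for all n indices, and these values add up to [M 1]. *)
Lemma sum_weight_mem1E i : \sum_A q A * (i \in A)%:R = M 1 / n%:R.
Proof.
have n0 : n%:R != 0 :> R.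
  by rewrite pnatr_eq0 -lt0n; exact: leq_ltn_trans (ltn_ord i).
apply: (canRL (mulfK n0)); rewrite mulr_natr.
have E j : \sum_A q A * (j \in A)%:R = \sum_A q A * (i \in A)%:R.
  have := sum_weight_mem j i (fun=> 1); under eq_bigr do rewrite mulr1.
  by move=> ->; apply: eq_bigr => A _; rewrite mulr1.
rewrite -[n in _ *+ n]card_ord -sumr_const.
rewrite -(eq_bigr _ (fun j _ => E j)) exchange_big; apply: eq_bigr => A _ /=.
by rewrite -mulr_sumr expr1 sum_mem_natrT.
Qed.

(** Double counting: summing over the n - 1 indices other than [i] turns the second membership into
    |A| - 1; summing then over [i] gives |A| (|A| - 1). *)
Lemma sum_weight_mem2E i j : j != i ->
  \sum_A q A * ((i \in A)%:R * (j \in A)%:R) = (M 2 - M 1) / (n%:R * (n%:R - 1)).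
Proof.
(* Two distinct indices force n > 1, so the denominator is nonzero. *)
move=> ji; have n1 : (1 < n)%N.
  by rewrite -[n]card_ord; apply/card_gt1P; exists i, j; split; rewrite // eq_sym.
have n0 : n%:R != 0 :> R by rewrite pnatr_eq0 -lt0n ltnW.
have n10 : n%:R - 1 != 0 :> R by rewrite subr_eq0 (eqr_nat _ n 1) gtn_eqF.
apply: (canRL (mulfK (mulf_neq0 n0 n10))).
set p2 := \sum_A _.
have E : p2 * (n%:R - 1) = \sum_A q A * ((i \in A)%:R * (#|A|%:R - 1)).
  rewrite -(natrB _ (ltnW n1)) mulr_natr.
  have -> : (n - 1)%N = #|[pred k | k != i]|.
    by rewrite -[n in LHS]card_ord subn1 -(cardC1 i); apply: eq_card => k; rewrite !inE.
  rewrite -sumr_const.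
  rewrite (eq_bigr (fun k => \sum_A q A * ((i \in A)%:R * (k \in A)%:R))); last first.
    by move=> k ki; apply: sum_weight_mem2.
  rewrite exchange_big; apply: eq_bigr => A _ /=.
  rewrite -!mulr_sumr; congr (_ * _).
  case: (boolP (i \in A)) => iA; rewrite ?mul0r // !mul1r.
  apply/eqP; rewrite eq_sym subr_eq addrC; apply/eqP.
  by rewrite -sum_mem_natrT (bigD1 i) //= iA.
rewrite [n%:R * _]mulrC mulrA E mulr_natr.
rewrite -[n in _ *+ n]card_ord -sumr_const.
rewrite (eq_bigr (fun k => \sum_A q A * ((k \in A)%:R * (#|A|%:R - 1)))); last first.
  by move=> k _; apply: (sum_weight_mem i k (fun m => m%:R - 1)).
rewrite exchange_big -sumrB; apply: eq_bigr => A _ /=.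
rewrite -mulr_sumr -mulr_suml -mulrBr; congr (_ * _).
by rewrite sum_mem_natrT; ring.
Qed.

(** Write |A :&: J| as a sum of memberships over [J]: the index [i] contributes the first moment
    term, each of the other |J| - 1 indices a pair term. *)
Lemma sum_weight_cardI i (J : {set 'I_n}) : i \in J ->
  \sum_A q A * ((i \in A)%:R * #|A :&: J|%:R) =
  M 1 / n%:R + (#|J|%:R - 1) * ((M 2 - M 1) / (n%:R * (n%:R - 1))).
Proof.
move=> iJ.
under eq_bigr do rewrite -sum_mem_natr !mulr_sumr.
rewrite exchange_big (bigD1 i) //=; congr (_ + _).
  rewrite -(sum_weight_mem1E i); apply: eq_bigr => A _.
  by case: (i \in A); rewrite ?mulr1 ?mulr0.
rewrite (eq_bigr _ (fun j ji => sum_weight_mem2E (proj2 (andP ji)))).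
rewrite sumr_const -[LHS]mulr_natl; congr (_ * _).
rewrite [in RHS](cardsD1 i J) iJ natrD /= addrAC subrr add0r; congr _%:R.
by apply: eq_card => j; rewrite !inE andbC.
Qed.

End SymmetricWeights.

(** * Expectations over a sampling as finite sums *)

Section FiniteExpectation.
Context {R : realType} {d : measure_display} {T : measurableType d}.
Context (P : probability T R) {n : nat} (S : T -> {set 'I_n}).
Context (mS : sampling S).

Definition set_prob (A : {set 'I_n}) : R := fine (P [set w | S w = A]%classic).

Lemma set_prob_ge0 A : 0 <= set_prob A.
Proof. by rewrite fine_ge0. Qed.

(** F(S) is a finite linear combination of indicators of the events S = A. *)
Lemma expectation_samplingE (F : {set 'I_n} -> R) :
  ('E_P[(fun w => F (S w))%R] = (\sum_A set_prob A * F A)%:E)%E.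
Proof.
pose E A := [set w | S w = A]%classic.
have mE A : measurable (E A) by exact: mS.
rewrite unlock (eq_integral (fun w => \sum_A (F A)%:E * (\1_(E A) w)%:E)%E).
  rewrite integral_sum //=; last by move=> A; apply/integrableZl/integrable_indic.
  rewrite -sumEFin; apply: eq_bigr => A _.
  rewrite integralZl //; last exact: integrable_indic.
  rewrite integral_indic // setIT mulrC EFinM /set_prob fineK //.
  by rewrite fin_num_measure.
move=> w _; rewrite (bigD1 (S w)) //= indicE mem_set // mule1 big1 ?adde0 // => A ASw.
by rewrite indicE memNset ?mule0 // /E /=; apply/eqP; rewrite eq_sym.
Qed.

Lemma card_momentE k : card_moment P S k = \sum_A set_prob A * #|A|%:R ^+ k.
Proof. by rewrite /card_moment (expectation_samplingE (fun A => #|A|%:R ^+ k)). Qed.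

Lemma prob_mem_samplingE i :
  P [set w | i \in S w]%classic = (\sum_A set_prob A * (i \in A)%:R)%:E.
Proof.
rewrite -(expectation_samplingE (fun A => (i \in A)%:R)) -[RHS]/('E_P[_])%E.
have mI : measurable [set w | i \in S w]%classic.
  rewrite (_ : mkset _ = \bigcup_(A in [set A : {set 'I_n} | i \in A]) [set w | S w = A])%classic.
    by apply: fin_bigcup_measurable => // A _; exact: mS.
  by apply/seteqP; split => w /=; [exists (S w)|case=> A /= iA ->].
rewrite -(expectation_indic P mI); congr expectation.
by apply/funext => w; rewrite indicE; congr (nat_of_bool _)%:R; apply/idP/idP; rewrite inE.
Qed.

End FiniteExpectation.

(** * Reduction from the separable summands to increments of [f] along single blocks *)

Section SeparableBound.
Context {R : realType} {n : nat} {Nb : 'I_n -> nat} (s : 'S_(\sum_i Nb i)%N).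
Implicit Types (x h : 'cV[R]_(\sum_i Nb i)%N).

Lemma depends_only_on_eq (J : {set 'I_n}) (g : 'cV[R]_(\sum_i Nb i)%N -> R) x i
    (t : 'cV[R]_(Nb i)) :
  depends_only_on s J g -> i \notin J -> g (x + Ublock s i *m t) = g x.
Proof.
move=> gJ iJ; apply: gJ => j jJ; rewrite blkD blk_Ublock_neq ?addr0 //.
by apply: contraNneq iJ => <-.
Qed.

(* Jensen's inequality for
   x + h_[I] = |I|^-1 \sum_(i in I) (x + |I| U_i h^(i)) with I = A :&: J. *)
Lemma convex_restr_le (J : {set 'I_n}) (g : 'cV[R]_(\sum_i Nb i)%N -> R) x h
    (A : {set 'I_n}) :
  convex_function
    (classical_sets.setT : set (convex_lmodType 'cV[R]_(\sum_i Nb i)%N)) g ->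
  depends_only_on s J g ->
  g (x + restr s h A) - g x <=
    \sum_(i in A :&: J) #|A :&: J|%:R^-1 *
      (g (x + Ublock s i *m (#|A :&: J|%:R *: blk s h i)) - g x).
Proof.
move=> gconv gJ; set I := A :&: J.
have -> : g (x + restr s h A) = g (x + restr s h I).
  apply: gJ => i iJ; rewrite !blkD !blk_restr inE iJ andbT //.
have [I0|I0] := eqVneq #|I| 0%N.
  by move/eqP: I0; rewrite cards_eq0 => /eqP ->; rewrite /restr !big_set0 addr0 subrr.
have c0 : #|I|%:R != 0 :> R by rewrite pnatr_eq0.
pose y i := x + Ublock s i *m (#|I|%:R *: blk s h i).
pose r := [seq y i | i <- enum I].
have sr : size r = #|I| by rewrite size_map -cardE.
have := @le_convex_mean R _ g r gconv.
rewrite -size_eq0 sr => /(_ I0); rewrite !big_map !big_enum /=.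
rewrite big_split /= sumr_const -[x *+ _]scaler_nat scalerDr scalerA mulVf // scale1r.
rewrite (eq_bigr (fun i => #|I|%:R *: (Ublock s i *m blk s h i))); last first.
  by move=> i _; rewrite -scalemxAr.
rewrite -scaler_sumr scalerA mulVf // scale1r -/(restr s h I).
rewrite -[\sum_(i in I) (_ * _)]mulr_sumr sumrB sumr_const mulrBr -[g x *+ _]mulr_natl.
by rewrite mulKf // lerD2r.
Qed.

Context (q : {set 'I_n} -> R).
Context (q_ge0 : forall A, 0 <= q A).
Context (q_sum1 : \sum_A q A = 1).
Context (q_card : forall A B : {set 'I_n}, #|A| = #|B| -> q A = q B).

Lemma separable_sum_le (omega m : nat) (J : 'I_m -> {set 'I_n})
    (fJ : 'I_m -> 'cV[R]_(\sum_i Nb i)%N -> R)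
    (f : 'cV[R]_(\sum_i Nb i)%N -> R) (J0 : 'I_n -> {set 'I_n}) x h :
  (forall k, #|J k| = omega) ->
  (forall i, i \in J0 i /\ #|J0 i| = omega) ->
  (forall k, convex_function
     (classical_sets.setT : set (convex_lmodType 'cV[R]_(\sum_i Nb i)%N)) (fJ k)) ->
  (forall k, depends_only_on s (J k) (fJ k)) ->
  (forall x, f x = \sum_k fJ k x) ->
  \sum_A q A * f (x + restr s h A) - f x <=
    \sum_i \sum_A q A * ((i \in A)%:R * (#|A :&: J0 i|%:R^-1 *
      (f (x + Ublock s i *m (#|A :&: J0 i|%:R *: blk s h i)) - f x))).
Proof.
move=> cJ cJ0 fconv fdep fE.
pose D k i (c : nat) := c%:R^-1 *
  (fJ k (x + Ublock s i *m (c%:R *: blk s h i)) - fJ k x).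
have -> : \sum_A q A * f (x + restr s h A) - f x =
    \sum_A q A * \sum_k (fJ k (x + restr s h A) - fJ k x).
  rewrite -[f x in LHS]mul1r -q_sum1 mulr_suml -sumrB; apply: eq_bigr => A _.
  by rewrite -mulrBr sumrB -!fE.
have -> : \sum_i \sum_A q A * ((i \in A)%:R * (#|A :&: J0 i|%:R^-1 *
      (f (x + Ublock s i *m (#|A :&: J0 i|%:R *: blk s h i)) - f x))) =
    \sum_k \sum_i \sum_A q A * ((i \in A)%:R * D k i #|A :&: J0 i|).
  rewrite [RHS]exchange_big; apply: eq_bigr => i _.
  rewrite [RHS]exchange_big; apply: eq_bigr => A _.
  by rewrite -!mulr_sumr sumrB -!fE.
(* Symmetry exchanges [J0 i] for [J k] when i lies in [J k]. Otherwise both sides vanish: on the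
   left [fJ k] is constant along block [i], on the right the membership is 0. *)
have -> : \sum_k \sum_i \sum_A q A * ((i \in A)%:R * D k i #|A :&: J0 i|) =
    \sum_k \sum_i \sum_A q A * ((i \in A :&: J k)%:R * D k i #|A :&: J k|).
  apply: eq_bigr => k _; apply: eq_bigr => i _; have [iJ0 cJ0i] := cJ0 i.
  have [iJ|iJ] := boolP (i \in J k).
    rewrite -(sum_weight_setI q_card (J := J k)) ?cJ ?cJ0i //.
    by apply: eq_bigr => A _; rewrite inE iJ andbT.
  rewrite !big1 // => A _.
    by rewrite inE (negbTE iJ) andbF mul0r mulr0.
  by rewrite /D (depends_only_on_eq _ _ (fdep k)) // subrr !mulr0.
have -> : \sum_k \sum_i \sum_A q A * ((i \in A :&: J k)%:R * D k i #|A :&: J k|) =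
    \sum_A q A * \sum_k \sum_i (i \in A :&: J k)%:R * D k i #|A :&: J k|.
  transitivity (\sum_k \sum_A q A *
                  \sum_i (i \in A :&: J k)%:R * D k i #|A :&: J k|).
    apply: eq_bigr => k _; rewrite exchange_big.
    by apply: eq_bigr => A _; rewrite mulr_sumr.
  by rewrite exchange_big; apply: eq_bigr => A _; rewrite mulr_sumr.
apply: ler_sum => A _; apply: ler_wpM2l => //; apply: ler_sum => k _.
apply: (le_trans (convex_restr_le _ _ _ (fconv k) (fdep k))).
rewrite big_mkcond; apply: ler_sum => i _.
by case: ifP; rewrite ?mul1r ?mul0r.
Qed.

End SeparableBound.

(** * The expected separable overapproximation *)

Theorem theorem15 (R : realType) (n : nat) (Nb : 'I_n -> nat)
    (hNb : forall i, (1 <= Nb i)%N)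
    (s : 'S_(\sum_i Nb i)%N)
    (B : forall i : 'I_n, 'M[R]_(Nb i)) (hB : forall i, sym_posdef (B i))
    (omega : nat) (L : 'I_n -> R) (f : 'cV[R]_(\sum_i Nb i)%N -> R)
    (hsep : partially_separable s omega f)
    (hlip : block_lipschitz s B L f)
    (d : measure_display) (T : measurableType d) (P : probability T R)
    (S : T -> {set 'I_n}) (hS : sampling S)
    (hproper : proper_sampling P S) (hdu : doubly_uniform_sampling P S) :
  ESO s B P f S
    (1 + (omega%:R - 1) * (card_moment P S 2 / card_moment P S 1 - 1)
           / Num.max 1 (n%:R - 1))
    L.
Proof.
case: hsep => /andP[omega_gt0 omega_le] [m [J [fJ [Jc fconv fdiff fdep fE]]]].
have n_gt0 : (0 < n)%N := leq_trans omega_gt0 omega_le.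
pose q := set_prob P S.
have q_ge0 A : 0 <= q A := set_prob_ge0 P S A.
have q_card (A A' : {set 'I_n}) : #|A| = #|A'| -> q A = q A'.
  by move=> AA'; rewrite /q /set_prob (hdu A A' AA').
have q_sum1 : \sum_A q A = 1.
  have := expectation_samplingE P hS (fun=> 1); rewrite expectation_cst => -[->].
  by apply: eq_bigr => A _; rewrite mulr1.
have p1E i : \sum_A q A * (i \in A)%:R = card_moment P S 1 / n%:R.
  by rewrite (sum_weight_mem1E q_card) card_momentE.
set M1 := card_moment P S 1; set M2 := card_moment P S 2.
have n0 : 0 < n%:R :> R by rewrite ltr0n.
have M1_gt0 : 0 < M1.
  (* Any index serves: its inclusion probability is M1 / n, positive by properness. *)
  have := hproper (Ordinal n_gt0).
  by rewrite prob_mem_samplingE // lte_fin p1E pmulr_lgt0 // invr_gt0.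
have M1_le2 : M1 <= M2.
  rewrite /M1 /M2 !card_momentE //; apply: ler_sum => A _.
  apply: ler_wpM2l; first exact: q_ge0.
  by rewrite -!natrX ler_nat; case: #|A| => // a; rewrite leq_pexp2l.
have omega1 : 0 <= omega%:R - 1 :> R by rewrite subr_ge0 ler1n.
set beta := 1 + _.
have beta_gt0 : 0 < beta.
  apply: ltr_wpDr => //; apply: divr_ge0; last by rewrite le_max ler01.
  by apply: mulr_ge0 => //; rewrite subr_ge0 ler_pdivlMr // mul1r.
split; [by [] | by case: hlip | split => // | ].
  by move=> i j; rewrite !prob_mem_samplingE // !p1E.
move=> x h; rewrite (expectation_samplingE P hS (fun A => f (x + restr s h A))) lee_fin.
(* Padding all sets to the common size [omega] is what allows a permutation to carry one to
   another. *)
have /choice[K KP] : forall k, exists K : {set 'I_n}, J k \subset K /\ #|K| = omega.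
  move=> k; have [|K JK cK] := @exists_superset_card _ (J k) omega.
    by rewrite (Jc k).2 card_ord.
  by exists K.
have /choice[J0 J0P] : forall i : 'I_n, exists K : {set 'I_n}, i \in K /\ #|K| = omega.
  move=> i; have [|I iI cI] := @exists_superset_card _ [set i]%SET omega.
    by rewrite cards1 card_ord omega_gt0.
  by exists I; rewrite -finset.sub1set.
have Kdep k : depends_only_on s (K k) (fJ k).
  by move=> y z yz; apply: fdep => i iJ; apply: yz; apply: (fintype.subsetP (KP k).1).
have fd y : differentiable f y.
  rewrite (_ : f = \sum_k fJ k); first exact: differentiable_sum.
  by apply/funext => z; rewrite fE fct_sumE.
rewrite -lerBlDl.
apply: (le_trans (separable_sum_le q_ge0 q_sum1 q_card x h
  (fun k => (KP k).2) J0P fconv Kdep fE)).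
have step i : \sum_A q A * ((i \in A)%:R * (#|A :&: J0 i|%:R^-1 *
      (f (x + Ublock s i *m (#|A :&: J0 i|%:R *: blk s h i)) - f x))) <=
    M1 / n%:R * (inner (gradient f x) (Ublock s i *m blk s h i)
                  + beta / 2 * (L i * bnorm B (blk s h i) ^+ 2)).
  have [iJ0 cJ0] := J0P i.
  set g := inner _ _; set b := L i * _.
  (* The origin of [beta]: it is the mean of |S :&: J0 i| conditioned on i belonging to S. *)
  have pb : M1 / n%:R * beta =
      \sum_A q A * ((i \in A)%:R * #|A :&: J0 i|%:R).
    rewrite (sum_weight_cardI q_card iJ0) cJ0 -!card_momentE // -/M1 -/M2 /beta.
    (* For n = 1 the pair term has denominator n (n - 1) = 0, but omega = 1 gives it the coefficient
       0. For n >= 2 the maximum is n - 1. *)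
    have [n1|n1] := leqP n 1.
      have -> : omega = 1%N by apply/eqP; rewrite eqn_leq omega_gt0 (leq_trans omega_le).
      by rewrite subrr !mul0r !addr0 mulr1.
    have n2 : 2 <= n%:R :> R by rewrite (ler_nat _ 2 n).
    rewrite max_r; last lra.
    by field; rewrite !gt_eqF //; lra.
  have -> : M1 / n%:R * (g + beta / 2 * b) =
      \sum_A q A * ((i \in A)%:R * (g + #|A :&: J0 i|%:R * (b / 2))).
    have -> : M1 / n%:R * (g + beta / 2 * b) =
        M1 / n%:R * g + (M1 / n%:R * beta) * (b / 2) by field; rewrite gt_eqF.
    rewrite pb -(p1E i) !mulr_suml -big_split; apply: eq_bigr => A _ /=; ring.
  apply: ler_sum => A _; apply: ler_wpM2l => //.
  have [iA|_] := boolP (i \in A); last by rewrite !mul0r.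
  rewrite !mul1r; set c := #|A :&: J0 i|%:R.
  have c0 : 0 < c :> R.
    by rewrite ltr0n; apply/card_gt0P; exists i; rewrite inE iA.
  (* The descent lemma with increment c h^(i) has linear term c g and quadratic term c^2 b / 2;
     dividing by [c] leaves g + c b / 2. *)
  rewrite ler_pdivrMl //.
  have := block_descent hB fd hlip x (c *: blk s h i).
  rewrite -scalemxAr innerZr -/g bnormZ exprMn real_normK ?num_real // scalemxAr.
  by rewrite /b; lra.
apply: (le_trans (ler_sum _ (fun i _ => step i))).
(* Summed over the blocks, the linear terms give the inner product with [h] and the quadratic ones
   the squared weighted norm. *)
rewrite -mulr_sumr big_split /= -inner_sumr sum_Ublock_blk -mulr_sumr.
rewrite /wnorm sqr_sqrtr //; apply: sumr_ge0 => i _.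
by apply: mulr_ge0; [apply/ltW; case: hlip|exact: sqr_ge0].
Qed.
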